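(* For every constant $c\ge 1$ there is a constant $C>0$ (depending only on $c$) such that every graph $G=(V,E)$ with $n=|V|\ge 2$ vertices, minimum degree $\delta$ and maximum degree $\Delta\le c\,\delta$ satisfies $$\mathcal{R}(G)\;\ge\; C\cdot\frac{\delta^2}{n}\cdot\frac{1}{\log n}.$$
   Context: Graphs are finite, undirected, simple and connected. A random walk on $G$ moves at each step from its current vertex to a neighbor chosen uniformly at random. The cover time $\mathsf{COV}(s)$ is the expected number of steps for the walk started at $s$ to visit all vertices, and $\mathsf{COV}(G)=\max_{s\in V}\mathsf{COV}(s)$. Randomized broadcast algorithm $\mathsf{RBA}$ (push algorithm): at time $0$ only a vertex $s$ knows a rumor; at each time step $t=1,2,\dots$ every vertex that knows the rumor chooses, independently, a neighbor uniformly at random and informs it. $I_t$ is the set of informed vertices at time $t$ ($I_0=\{s\}$). The expected broadcast time is $\mathbf{E}[\mathsf{RBA}(G)]:=\max_{s\in V}\mathbf{E}[\min\{t: I_t=V\}\text{ with } I_0=\{s\}]$. Finally $\mathcal{R}(G):=\mathsf{COV}(G)/\mathbf{E}[\mathsf{RBA}(G)]$. *)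

(* Defs.v *)
From HB Require Import structures.
From mathcomp Require Export all_boot all_order all_algebra.
From mathcomp Require Export reals ereal sequences exp.

Set Implicit Arguments.
Unset Strict Implicit.
Unset Printing Implicit Defensive.

Import Order.TTheory GRing.Theory Num.Theory.
Local Open Scope ring_scope.

Section FiniteMarkovChain.
Variables (R : realType) (S : finType).
(* [p x y] is the probability to move from [x] to [y]. *)
Variable p : S -> S -> R.

(* P(X_1 = h_0, ..., X_t = h_(t-1)) for the chain started at X_0 = x. *)
Fixpoint history_prob (x : S) (h : seq S) : R :=
  if h is y :: h' then p x y * history_prob y h' else 1.

(* [A] is a property of the trajectory (X_0, ..., X_t) observed so far;
   [first_time A x h] says that it holds at time [size h] and at no earlier
   time. *)
Definition first_time (A : pred (seq S)) (x : S) (h : seq S) : bool :=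
  A (x :: h) && [forall i : 'I_(size h), ~~ A (x :: take i h)].

(* P(T = t), where T = min {t : A (X_0, ..., X_t)} and X_0 = x; this event
   depends only on the first [t] steps. *)
Definition stop_prob (A : pred (seq S)) (x : S) (t : nat) : R :=
  \sum_(h : t.-tuple S | first_time A x h) history_prob x h.

(* E[T] = \sum_t t P(T = t) + oo * P(T = oo), with oo * 0 = 0. *)
Definition expected_stop (A : pred (seq S)) (x : S) : \bar R :=
  (\sum_(0 <= t <oo) (t%:R * stop_prob A x t)%:E
   + +oo * (1 - \sum_(0 <= t <oo) (stop_prob A x t)%:E))%E.

End FiniteMarkovChain.

Section Graph.
Variables (R : realType) (V : finType) (e : rel V).

Definition deg (v : V) : nat := #|[set w | e v w]|.

(* Degrees in a simple graph are less than #|V|, so the default value is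
   harmless. *)
Definition mindeg : nat := \big[minn/#|V|]_(v : V) deg v.

Definition maxdeg : nat := \max_(v : V) deg v.

(* The uniform distribution on the neighbours of [v]. *)
Definition nbr_prob (v w : V) : R := if e v w then (deg v)%:R^-1 else 0.

Definition COV_from (s : V) : \bar R :=
  expected_stop nbr_prob (fun h => [forall v, v \in h]) s.

Definition COV : \bar R := \big[maxe/-oo%E]_(s : V) COV_from s.

(* One round of RBA: [f] collects the independent choices of the informed
   vertices. *)
Definition push_prob (I J : {set V}) : R :=
  \sum_(f : {ffun {v : V | v \in I} -> V} | I :|: [set w in codom f] == J)
     \prod_(u : {v : V | v \in I}) nbr_prob (val u) (f u).

Definition RBA_from (s : V) : \bar R :=
  expected_stop push_prob (fun h => last set0 h == [set: V]) [set s].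

Definition RBA : \bar R := \big[maxe/-oo%E]_(s : V) RBA_from s.

Definition cover_broadcast_ratio : \bar R := (COV / RBA)%E.

End Graph.

(* Main.v *)
(* A set [U] of vertices is left through [cut U] edges, and reversibility shows that the
   walk started at a suitable vertex of [U] needs expected time at least
   vol(U) / cut(U) to leave [U]. Hence M := COV satisfies cut(U) >= n delta / (2 M) for
   every proper nonempty [U], and n <= 2 c M.
   Conversely, RBA is bounded by a constant times the maximum, over all maximal chains
   I = J_0 < J_1 < ... < V of informed sets growing by one vertex, of
   sum_i Delta / cut(J_i). If two sets of a chain differ by d <= delta / 2 vertices, then
   these d vertices send at least d delta / 2 edges elsewhere, so the two cuts add up to
   at least d delta / 2. Therefore a window of delta / 2 consecutive sets contributes
   O(Delta / min cut + log n), and RBA = O((n / delta) (M / n + log n))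
   = O(M log n / delta), which is at most O(M n log n / delta^2). *)
Require Import Defs.
From mathcomp Require Import ring lra zify.

Set Implicit Arguments.
Unset Strict Implicit.
Unset Printing Implicit Defensive.

Import Order.TTheory GRing.Theory Num.Theory.
Local Open Scope ring_scope.

(** * Truncated stopping times *)

Section StoppingTimes.
Variables (R : realType) (S : finType) (p : S -> S -> R).
Hypothesis p_ge0 : forall x y, 0 <= p x y.
Hypothesis p_sum : forall x, \sum_y p x y = 1.
Implicit Types (A : pred (seq S)) (x y : S).

Lemma first_time_cons A x y h :
  first_time A x (y :: h)
  = ~~ A [:: x] && first_time (fun h' => A (x :: h')) y h.
Proof.
rewrite /first_time andbCA; congr (_ && _).
apply/forallP/andP => [H|[H0 /forallP H] [[|i] lt_i]] //=.
  split; first exact: (H ord0).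
  apply/forallP => i; exact: (H (lift ord0 i)).
exact: (H (Ordinal (lt_i : i < size h)%N)).
Qed.

Lemma stop_prob0 A x : stop_prob p A x 0 = (A [:: x])%:R.
Proof.
rewrite /stop_prob; case: (boolP (A [:: x])) => Ax.
  rewrite (big_pred1 [tuple]) //= => h; rewrite [h]tuple0 [RHS]eqxx.
  by rewrite /first_time /= Ax; apply/forallP => -[].
by rewrite big_pred0 // => h; rewrite [h]tuple0 /first_time /= (negPf Ax).
Qed.

(** First-step analysis. Seen from [y], the property still remembers [x], so the inductions below
    have to generalize over [A]. *)
Lemma stop_probS A x t :
  stop_prob p A x t.+1 =
  if A [:: x] then 0
  else \sum_y p x y * stop_prob p (fun h => A (x :: h)) y t.
Proof.
rewrite /stop_prob.
rewrite (reindex (fun q : S * t.-tuple S => [tuple of q.1 :: q.2])) /=; last first.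
  exists (fun h => (thead h, [tuple of behead h])) => [[y h] _|h _] /=.
    by rewrite theadE; congr (_, _); apply: val_inj.
  by rewrite -tuple_eta.
under eq_bigl => q do rewrite first_time_cons.
case: ifP => Ax; first by rewrite big_pred0.
rewrite -(pair_big_dep xpredT
  (fun y (h : t.-tuple S) => first_time (fun h' => A (x :: h')) y h)
  (fun y h => p x y * history_prob p y h)) /=.
by apply: eq_bigr => y _; rewrite big_distrr.
Qed.

Lemma stop_prob_ge0 A x t : 0 <= stop_prob p A x t.
Proof.
elim: t A x => [|t IH] A x; first by rewrite stop_prob0 ler0n.
rewrite stop_probS; case: ifP => // _; apply: sumr_ge0 => y _.
by rewrite mulr_ge0.
Qed.

(* E[min(T, N)] *)
Definition truncated_stop A x (N : nat) : R :=
  \sum_(0 <= t < N) t%:R * stop_prob p A x t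
  + N%:R * (1 - \sum_(0 <= t < N) stop_prob p A x t).

Lemma truncated_stop0 A x : truncated_stop A x 0 = 0.
Proof. by rewrite /truncated_stop big_geq // mul0r addr0. Qed.

Lemma truncated_stopS A x N :
  truncated_stop A x N.+1 =
  if A [:: x] then 0
  else 1 + \sum_y p x y * truncated_stop (fun h => A (x :: h)) y N.
Proof.
rewrite /truncated_stop !big_nat_recl // stop_prob0 mul0r add0r.
case: ifP => Ax.
  rewrite !big1_seq ?add0r ?addr0 ?subrr ?mulr0 // => t _;
  by rewrite stop_probS Ax ?mulr0.
set sp := fun y t => stop_prob p (fun h => A (x :: h)) y t.
have E t : stop_prob p A x t.+1 = \sum_y p x y * sp y t by rewrite stop_probS Ax.
under eq_bigr => t _ do rewrite E.
under [X in 0%R + X]eq_bigr => t _ do rewrite E.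
rewrite add0r.
have -> : \sum_(0 <= t < N) \sum_y p x y * sp y t
          = \sum_y p x y * \sum_(0 <= t < N) sp y t.
  by rewrite exchange_big; apply: eq_bigr => y _; rewrite big_distrr.
have -> : \sum_(0 <= t < N) t.+1%:R * (\sum_y p x y * sp y t)
          = \sum_y p x y * (\sum_(0 <= t < N) t%:R * sp y t
                            + \sum_(0 <= t < N) sp y t).
  under eq_bigr => t _ do rewrite big_distrr.
  rewrite exchange_big; apply: eq_bigr => y _; rewrite -big_split big_distrr.
  by apply: eq_bigr => t _ /=; rewrite -natr1; ring.
have one_add F : 1 + \sum_y F y = \sum_y (p x y + F y) by rewrite big_split p_sum.
rewrite -sumrN !one_add big_distrr -big_split /=.
by apply: eq_bigr => y _ /=; rewrite -natr1; ring.
Qed.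

Lemma stop_prob_sum_le1 A x N : \sum_(0 <= t < N) stop_prob p A x t <= 1.
Proof.
elim: N A x => [|N IH] A x; first by rewrite big_geq.
rewrite big_nat_recl // stop_prob0; case: (boolP (A [:: x])) => Ax.
  by rewrite big1 ?addr0 // => t _; rewrite stop_probS Ax.
rewrite add0r; under eq_bigr => t _ do rewrite stop_probS (negPf Ax).
rewrite exchange_big -(p_sum x); apply: ler_sum => y _.
by rewrite -big_distrr /= ler_piMr.
Qed.

Lemma truncated_stop_ge0 A x N : 0 <= truncated_stop A x N.
Proof.
apply: addr_ge0.
  by apply: sumr_ge0 => t _; rewrite mulr_ge0 ?stop_prob_ge0.
by rewrite mulr_ge0 // subr_ge0 stop_prob_sum_le1.
Qed.

Local Open Scope ereal_scope.

Let sp A x t := (stop_prob p A x t)%:E.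

Let sp_ge0 A x t : 0 <= sp A x t.
Proof. by rewrite lee_fin stop_prob_ge0. Qed.

Let tsp_ge0 A x t : 0 <= (t%:R * stop_prob p A x t)%:E.
Proof. by rewrite lee_fin mulr_ge0 ?stop_prob_ge0. Qed.

Let sp_sum_le1 A x : \sum_(0 <= t <oo) sp A x t <= 1.
Proof.
apply: ereal_normedtype.lime_le; first exact: is_cvg_nneseries.
by apply: filter.nearW => n; rewrite sumEFin lee_fin stop_prob_sum_le1.
Qed.

Lemma expected_stop_ge0 A x : 0 <= expected_stop p A x.
Proof.
apply: adde_ge0; first exact: nneseries_ge0.
apply: mule_ge0; first exact: leey.
by rewrite sube_ge0 ?sp_sum_le1 // orbT.
Qed.

(** If with positive probability the chain never stops, the right side is infinite. Otherwise the
    stopping probabilities add up to 1, and weighting them by [N <= t + (N - t)], with truncated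
    subtraction, gives the bound. *)
Lemma truncated_stop_le A x N : (truncated_stop A x N)%:E <= expected_stop p A x.
Proof.
rewrite /expected_stop -/(sp A x).
have := sp_sum_le1 A x; rewrite le_eqVlt => /predU1P[s1|lt1]; last first.
  rewrite gt0_mulye ?sube_gt0 // addey ?leey //.
  by rewrite gt_eqF // (lt_le_trans (ltNyr 0%R)) //; exact: nneseries_ge0.
rewrite s1 subee // mule0 adde0.
have finE : \sum_(0 <= t < N) ((N - t)%:R * stop_prob p A x t)%:E
   = \sum_(0 <= t <oo) ((N - t)%:R * stop_prob p A x t)%:E.
  rewrite (@nneseries_split _ _ 0 N); last first.
    by move=> k _; rewrite lee_fin mulr_ge0 ?stop_prob_ge0.
  rewrite add0n [X in _ = _ + X]eseries0 ?adde0 // => i lei _.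
  by rewrite (eqP (lei : N - i == 0)%N) mul0r.
have key : N%:R%:E <= \sum_(0 <= t <oo) (t%:R * stop_prob p A x t)%:E
   + \sum_(0 <= t < N) ((N - t)%:R * stop_prob p A x t)%:E.
  rewrite finE -nneseriesD //; last first.
    by move=> k _ _; rewrite lee_fin mulr_ge0 ?stop_prob_ge0.
  have -> : N%:R%:E = \sum_(0 <= t <oo) (N%:R%:E * sp A x t).
    by rewrite nneseriesZl ?s1 ?mule1.
  apply: lee_nneseries => [t _|t _].
    by rewrite mule_ge0 // lee_fin.
  rewrite -EFinM -EFinD lee_fin -mulrDl.
  apply: ler_wpM2r; first by apply: stop_prob_ge0.
  by rewrite -natrD ler_nat; lia.
move: key; rewrite sumEFin.
case: (\sum_(0 <= t <oo) _)
  (nneseries_ge0 (P := xpredT) (fun t (_ : (0 <= t)%N) _ => tsp_ge0 A x t)) => [r||] //.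
  move=> _; rewrite -EFinD !lee_fin /truncated_stop => key.
  rewrite mulrBr mulr1 mulr_sumr; move: key.
  under [X in (_ <= _ + X)%R -> _]eq_big_nat => t /andP[_ ltN].
    rewrite natrB ?(ltnW ltN) // mulrBl; over.
  rewrite sumrB; lra.
by move=> _ _; rewrite leey.
Qed.

(** A Markov-type argument: [N] times the probability of not stopping before [N] is at most [G], so
    the chain stops almost surely and the infinite term vanishes. *)
Lemma expected_stop_le A x (G : R) :
  (forall N, truncated_stop A x N <= G)%R -> expected_stop p A x <= G%:E.
Proof.
move=> le_G; have G0 : (0 <= G)%R by apply: le_trans (le_G 0%N); rewrite truncated_stop0.
have s1 : \sum_(0 <= t <oo) sp A x t = 1.
  apply/eqP; rewrite eq_le sp_sum_le1 /=; apply/lee_addgt0Pr => eps eps0.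
  (* Chosen so that [G < N * eps]: the mass missing at time [N] is then below [eps]. *)
  pose N := (Num.truncn (G / eps)).+1.
  have N0 : (0 < N%:R :> R)%R by rewrite ltr0n.
  apply: (@le_trans _ _ (\sum_(0 <= t < N) sp A x t + eps%:E)); last first.
    by rewrite leeD2r // nneseries_lim_ge.
  rewrite sumEFin -EFinD lee_fin -lerBlDl -(ler_pM2l N0).
  have ltN : (G < N%:R * eps)%R.
    by rewrite -ltr_pdivrMr // truncnS_gt.
  apply: le_trans (ltW ltN); apply: le_trans (le_G N).
  by rewrite lerDr sumr_ge0 // => t _; rewrite mulr_ge0 ?stop_prob_ge0.
rewrite /expected_stop -/(sp A x) s1 subee // mule0 adde0.
apply: ereal_normedtype.lime_le; first exact: is_cvg_nneseries.
apply: filter.nearW => N; rewrite sumEFin lee_fin; apply: le_trans (le_G N).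
by rewrite lerDl mulr_ge0 // subr_ge0 stop_prob_sum_le1.
Qed.

(** While [B] fails, [g] loses at least 1 per step on average, so its initial value pays for the
    whole run. The invariant [Q] confines the drift condition to relevant states; [s0] is a mere
    default, trajectories being nonempty. *)
Lemma expected_stop_supermartingale (Q B : pred S) s0 (g : S -> R) x :
  (forall y z, Q y -> ~~ B y -> p y z != 0%R -> Q z) ->
  (forall y, 0 <= g y)%R ->
  (forall y, Q y -> ~~ B y -> 1 + \sum_z p y z * g z <= g y)%R ->
  Q x -> expected_stop p (fun h => B (last s0 h)) x <= (g x)%:E.
Proof.
move=> Qp g0 gle Qx; apply: expected_stop_le => N.
have : forall A, (forall y h, A (y :: h) = B (last y h)) ->
    forall N x, Q x -> (truncated_stop A x N <= g x)%R.
  move=> {}A AE {}N; elim: N A AE => [|N IH] A AE {Qx}x Qx.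
    by rewrite truncated_stop0.
  rewrite truncated_stopS AE /=; case: ifPn => // Bx.
  apply: le_trans (gle _ Qx Bx); rewrite lerD2l; apply: ler_sum => y _.
  have [->|pxy] := eqVneq (p x y) 0%R; first by rewrite !mul0r.
  rewrite ler_wpM2l //; apply: (IH (fun h => A (x :: h))) => //=; last exact: Qp pxy.
  by move=> z h; rewrite AE.
by apply.
Qed.

(* E[min(T, N)] for the exit time T of the set U *)
Fixpoint truncated_exit (U : {set S}) (N : nat) (x : S) : R :=
  if N is N'.+1 then
    (if x \in U then 1 + \sum_(y in U) p x y * truncated_exit U N' y else 0)%R
  else 0%R.

Lemma truncated_exit_le (U : {set S}) N A x :
  (forall h, A h -> ~~ all [in U] h) ->
  (truncated_exit U N x <= truncated_stop A x N)%R.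
Proof.
elim: N A x => [|N IH] A x AU /=; first by rewrite truncated_stop0.
case: ifP => Ux; last exact: truncated_stop_ge0.
rewrite truncated_stopS.
case: ifP => [/AU|_]; first by rewrite /= Ux.
rewrite lerD2l big_mkcond; apply: ler_sum => y _.
case: ifP => _; last by rewrite mulr_ge0 ?truncated_stop_ge0.
by rewrite ler_wpM2l // IH // => h /AU; rewrite /= Ux.
Qed.

End StoppingTimes.

(** * Edge cuts and the cover time *)

Section Cuts.
Local Open Scope nat_scope.
Variables (V : finType) (e : rel V).
Hypothesis e_sym : symmetric e.
Implicit Types (I U : {set V}) (u v w : V).

Definition outdeg U v : nat := \sum_(w in ~: U) e v w.

Definition cut U : nat := \sum_(v in U) outdeg U v.

Lemma degE v : deg e v = \sum_w e v w.
Proof.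
rewrite /deg -sum1_card big_mkcond; apply: eq_bigr => w _.
by rewrite inE; case: (e v w).
Qed.

Lemma outdeg_le U v : outdeg U v <= deg e v.
Proof. by rewrite degE [leqRHS](bigID (mem (~: U))) leq_addr. Qed.

Lemma deg_split U v : deg e v = \sum_(w in U) e v w + outdeg U v.
Proof.
rewrite degE (bigID (mem U)) /outdeg /=; congr (_ + _)%N.
by apply: eq_bigl => w; rewrite inE.
Qed.

Lemma cutC U : cut (~: U) = cut U.
Proof.
rewrite /cut /outdeg setCK exchange_big.
by apply: eq_bigr => v _; apply: eq_bigr => w _; rewrite e_sym.
Qed.

Lemma mindeg_le v : mindeg e <= deg e v.
Proof.
rewrite /mindeg; have: v \in index_enum V by rewrite mem_index_enum.
elim: index_enum => // w s IH; rewrite inE big_cons geq_min => /orP[/eqP->|/IH ->].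
  by rewrite leqnn.
by rewrite orbT.
Qed.

Lemma deg_le_maxdeg v : deg e v <= maxdeg e.
Proof. exact: leq_bigmax. Qed.

Lemma mindeg_le_card : mindeg e <= #|V|.
Proof.
by apply: (big_rec (fun m => m <= #|V|)) => // v x _ le_x; rewrite geq_min le_x orbT.
Qed.

(** A set with empty cut is closed under adjacency, so by connectedness it is everything once it is
    nonempty. *)
Lemma cut_gt0 U : (forall x y, connect e x y) ->
  U != set0 -> U != [set: V] -> 0 < cut U.
Proof.
move=> e_conn /set0Pn [x Ux] UT; rewrite lt0n; apply: contraNneq UT => cut0.
have out0 v w : v \in U -> w \notin U -> ~~ e v w.
  move=> Uv Uw; move/eqP: cut0; rewrite sum_nat_eq0 => /forall_inP/(_ v Uv).
  rewrite sum_nat_eq0 => /forall_inP/(_ w); rewrite inE Uw => /(_ isT).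
  by rewrite eqb0.
have clU : fingraph.closed e (mem U).
  apply: (intro_closed (sym_connect_sym e_sym)).
  by move=> v w evw Uv; apply: contraTT evw => /(out0 _ _ Uv).
rewrite -subTset; apply/subsetP => y _.
by rewrite -(closed_connect clU (e_conn x y)).
Qed.

Lemma deg_gt0 v : (forall x y, connect e x y) -> 1 < #|V| -> 0 < deg e v.
Proof.
move=> e_conn n_gt1; have : 0 < cut [set v]%SET.
  apply: cut_gt0 => //; first by apply/set0Pn; exists v; rewrite inE.
  by apply: contraTneq n_gt1 => /(congr1 (fun A : {set V} => #|A|)); rewrite cards1 cardsT => <-.
by rewrite /cut big_set1 => /leq_trans -> //; exact: outdeg_le.
Qed.

Lemma mindeg_gt0 : (forall x y, connect e x y) -> 1 < #|V| -> 0 < mindeg e.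
Proof.
move=> e_conn n_gt1; apply: (@big_ind _ (fun m => 0 < m)) => [|a b a0 b0|v _].
- exact: ltnW.
- by rewrite leq_min a0.
- exact: deg_gt0.
Qed.

(** An edge leaving [W :\: U] either ends in [U], and crosses the cut of [U], or leaves [W]. *)
Lemma cut_setD (U W : {set V}) : U \subset W -> cut (W :\: U) <= cut U + cut W.
Proof.
move=> UW; rewrite -(cutC U) /cut.
rewrite (eq_bigr (fun v => \sum_(w in U) e v w + outdeg W v)); last first.
  move=> v; rewrite inE => /andP[Uv Wv].
  rewrite /outdeg (bigID (mem U)) /=; congr (_ + _)%N.
    apply: eq_bigl => w; rewrite !inE; case Uw: (w \in U); rewrite ?andbF //.
  apply: eq_bigl => w; rewrite !inE; case Uw: (w \in U); rewrite ?andbF ?andbT //=.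
  by rewrite (subsetP UW _ Uw).
rewrite big_split leq_add //=.
  rewrite /outdeg setCK [leqRHS](bigID (mem (W :\: U))) /=.
  apply: leq_trans (leq_addr _ _); apply: eq_leq; apply: eq_bigl => v.
  by rewrite !inE; case: (v \in U).
rewrite [leqRHS](bigID (mem (W :\: U))) /=.
apply: leq_trans (leq_addr _ _); apply: eq_leq; apply: eq_bigl => v.
by rewrite !inE; case: (v \in W); rewrite ?andbF.
Qed.

(** A vertex of [U] has at most [#|U|] neighbours inside [U]. Truncated subtraction makes the bound
    trivial for large [U]. *)
Lemma cut_small U : #|U| * (mindeg e - #|U|) <= cut U.
Proof.
rewrite /cut -sum_nat_const; apply: leq_sum => v Uv.
rewrite leq_subLR; apply: leq_trans (mindeg_le v) _.
rewrite (deg_split U) leq_add2r -sum1_card; apply: leq_sum => w _.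
exact: leq_b1.
Qed.

Lemma cut_setU1 U v : v \notin U -> cut (v |: U) <= cut U + maxdeg e.
Proof.
move=> Uv; rewrite /cut big_setU1 //= addnC leq_add //.
  apply: leq_sum => w _; rewrite /outdeg [leqRHS](bigID (mem (~: (v |: U)))) /=.
  apply: leq_trans (leq_addr _ _); apply: eq_leq; apply: eq_bigl => x.
  by rewrite !inE; case: (x == v) => //=; rewrite ?andbF ?andbb.
exact: leq_trans (outdeg_le _ _) (deg_le_maxdeg _).
Qed.

End Cuts.

(** * Reversibility: volumes bounded by cover time and cuts *)

Section CoverTime.
Variables (R : realType) (V : finType) (e : rel V).
Hypothesis e_sym : symmetric e.
Hypothesis deg_pos : forall v, (0 < deg e v)%N.
Implicit Types (U : {set V}) (v w : V).

Lemma nbr_prob_ge0 v w : 0 <= nbr_prob R e v w.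
Proof. by rewrite /nbr_prob; case: ifP => // _; rewrite invr_ge0. Qed.

Lemma nbr_probE v w : nbr_prob R e v w = (e v w)%:R / (deg e v)%:R.
Proof. by rewrite /nbr_prob; case: ifP; rewrite ?mul1r ?mul0r. Qed.

Lemma nbr_prob_sum v : \sum_w nbr_prob R e v w = 1.
Proof.
under eq_bigr => w _ do rewrite nbr_probE.
by rewrite -big_distrl /= -natr_sum -degE divff // pnatr_eq0 -lt0n deg_pos.
Qed.

(* Reversibility: for the truncated exit time [h], one step of the killed walk gives
   [sum deg h_(N+1) = vol U + sum deg h_N - sum outdeg h_N]. As [h] is bounded by [M],
   the increments [vol U - M * cut U] cannot be positive. *)
Lemma exit_time_cut U (M : R) :
  (forall N v, truncated_exit (nbr_prob R e) U N v <= M) ->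
  \sum_(v in U) (deg e v)%:R <= M * (cut e U)%:R.
Proof.
set h := truncated_exit _ U => hM; rewrite leNgt; apply/negP.
set vol := \sum_(v in U) _ => lt_vol.
pose D N := \sum_(v in U) (deg e v)%:R * h N v.
have D_step N : vol + D N - M * (cut e U)%:R <= D N.+1.
  (* After exchanging the sums, [deg v] times the transition probability is the symmetric
     [e v w]. *)
  have -> : D N.+1 = vol + \sum_(w in U) (\sum_(v in U) (e w v)%:R) * h N w.
    under [X in _ + X]eq_bigr => w _ do rewrite big_distrl.
    rewrite exchange_big -big_split /=; apply: eq_bigr => v Uv.
    rewrite /h /= Uv mulrDr mulr1; congr (_ + _); rewrite big_distrr.
    apply: eq_bigr => w _ /=; rewrite nbr_probE e_sym -/(h N w) mulrA; congr (_ * _).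
    by rewrite mulrC divfK // pnatr_eq0 -lt0n deg_pos.
  rewrite -addrA lerD2l lerBlDr /cut natr_sum big_distrr -big_split.
  apply: ler_sum => v Uv; rewrite (deg_split e U) natrD natr_sum mulrDl lerD2l.
  by rewrite mulrC ler_wpM2r.
have D_ge N : N%:R * (vol - M * (cut e U)%:R) <= D N.
  elim: N => [|N IH].
    by rewrite mul0r sumr_ge0 // => v _; rewrite mulr0.
  by apply: le_trans (D_step N); rewrite -natr1; lra.
have D_le N : D N <= vol * M.
  by rewrite big_distrl; apply: ler_sum => v _; rewrite ler_wpM2l.
have gap : 0 < vol - M * (cut e U)%:R by rewrite subr_gt0.
set N := (Num.truncn (vol * M / (vol - M * (cut e U)%:R))).+1.
have := le_trans (D_ge N) (D_le N); apply/negP; rewrite -ltNge.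
by rewrite -ltr_pdivrMr // truncnS_gt.
Qed.

(** Covering all vertices forces the walk to leave the proper subset [U], so [M] bounds its
    truncated exit times from every start. *)
Lemma COV_cut U (M : R) : COV R e = M%:E -> U != [set: V] ->
  \sum_(v in U) (deg e v)%:R <= M * (cut e U)%:R.
Proof.
move=> covM UT; apply: exit_time_cut => N v; rewrite -lee_fin -covM.
apply: le_trans (le_bigmax _ _ v).
apply: le_trans (truncated_stop_le nbr_prob_ge0 nbr_prob_sum _ _ N).
rewrite lee_fin; apply: truncated_exit_le => [||h /forallP hV].
- exact: nbr_prob_ge0.
- exact: nbr_prob_sum.
apply: contra UT => /allP hU; rewrite -subTset; apply/subsetP => w _.
exact: hU (hV w).
Qed.

Lemma COV_ge0 v : (0 <= COV R e)%E.
Proof.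
apply: le_trans (le_bigmax _ _ v).
exact: expected_stop_ge0 nbr_prob_ge0 nbr_prob_sum _ _.
Qed.

End CoverTime.

(** * Sums of inverse cuts along a chain *)

Section Windows.
Variable (R : realType).

Definition harmonic_sum (l : nat) : R := \sum_(1 <= i < l) i%:R^-1.

Lemma harmonic_sum_mono k l : (k <= l)%N -> harmonic_sum k <= harmonic_sum l.
Proof.
move=> kl; rewrite /harmonic_sum; have [k1|k1] := leqP k 1.
  by rewrite big_geq // sumr_ge0.
by rewrite [leRHS](@big_cat_nat _ _ _ k) ?(ltnW k1) //= lerDl sumr_ge0.
Qed.

Lemma harmonic_sum_le_ln l : harmonic_sum l.+1 <= 1 + ln l%:R.
Proof.
(* The case [l = 0] relies on the default value [ln 0 = 0]. *)
case: l => [|l]; first by rewrite /harmonic_sum big_geq // ln0 // addr0.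
elim: l => [|l IH].
  by rewrite /harmonic_sum big_nat1 invr1 ln1 addr0.
rewrite /harmonic_sum big_nat_recr //= -/(harmonic_sum _).
have l1 : (0 : R) < l.+1%:R by rewrite ltr0n.
have l2 : (0 : R) < l.+2%:R by rewrite ltr0n.
apply: le_trans (lerD IH (lexx _)) _; rewrite -addrA lerD2l.
(* The inequality [ln (1 - x) <= - x] at [x = 1 / (l + 2)] bounds the new harmonic term by the
   increment of [ln]. *)
have : ln (1 + - l.+2%:R^-1) <= - l.+2%:R^-1 :> R.
  by apply: le_ln1Dx; rewrite ltrN2 invf_lt1 // ltr1n.
have -> : 1 + - l.+2%:R^-1 = l.+1%:R / l.+2%:R :> R.
  by rewrite -[l.+1%:R](addrK 1) natr1 mulrBl divff ?gt_eqF // mul1r.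
rewrite ln_div ?posrE // lerBlDl => H.
by rewrite -lerBrDr.
Qed.

(* At the minimizer [k] of [a] on the window, [a i >= kappa |i - k| / 2]. *)
Lemma window_sum_inv (a : nat -> R) (phi kappa : R) (l m N : nat) :
  0 < phi -> 0 < kappa -> (N <= l)%N ->
  (forall i, (m <= i < m + N)%N -> phi <= a i) ->
  (forall i j, (m <= i < j)%N -> (j < m + N)%N -> kappa * (j - i)%:R <= a i + a j) ->
  \sum_(m <= i < m + N) (a i)^-1 <= phi^-1 + 4 / kappa * harmonic_sum l.
Proof.
move=> phi0 kappa0 Nl le_phi le_kappa.
have rhs0 : 0 <= phi^-1 + 4 / kappa * harmonic_sum l.
  by rewrite addr_ge0 ?mulr_ge0 ?invr_ge0 ?(ltW phi0) ?(ltW kappa0) ?sumr_ge0.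
case: N => [|N] in Nl le_phi le_kappa *; first by rewrite addn0 big_geq.
case: (@Order.TotalTheory.arg_minP _ _ _ (ord0 : 'I_N.+1) xpredT
  (fun i => a (m + i)%N)) => //= k0 _ k0min.
set k := (m + k0)%N.
have kmin i : (m <= i < m + N.+1)%N -> a k <= a i.
  move=> /andP[mi iN]; have ltN : (i - m < N.+1)%N by lia.
  by have := k0min (Ordinal ltN) isT; rewrite /= subnKC.
have kN : (k < m + N.+1)%N by rewrite /k ltn_add2l.
have mk : (m <= k)%N by rewrite leq_addr.
(* Applied to [x = a i] at distance [d] from [k]: minimality of [a k] turns [a i + a k] into at most
   [2 * a i]. *)
have half x d : kappa * d%:R <= x + x -> (0 < d)%N -> x^-1 <= 2 / kappa * d%:R^-1.
  move=> le_x d0; have d1 : (0 : R) < d%:R by rewrite ltr0n.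
  rewrite -mulrA -invfM -[2]invrK -invfM lef_pV2 ?posrE; first by lra.
    by have := mulr_gt0 kappa0 d1; lra.
  by rewrite mulr_gt0 ?mulr_gt0 // invr_gt0 ltr0n.
rewrite (@big_cat_nat _ _ _ k) ?(ltnW kN) //= (@big_ltn _ _ _ k) //.
rewrite addrCA; apply: lerD.
  by rewrite lef_pV2 ?posrE ?le_phi ?mk // (lt_le_trans phi0) // le_phi ?mk.
have -> : 4 / kappa = 2 / kappa + 2 / kappa by rewrite -mulrDl; congr (_ / _); ring.
rewrite mulrDl; apply: lerD.
  (* The part left of [k] is summed in reverse, so that the index becomes the distance to [k]. *)
  apply: (@le_trans _ _ (2 / kappa * harmonic_sum k0.+1)); last first.
    rewrite ler_wpM2l ?divr_ge0 ?(ltW kappa0) //; apply: harmonic_sum_mono.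
    by apply: leq_trans Nl; exact: ltn_ord.
  rewrite /harmonic_sum big_distrr /= big_nat_rev /=.
  rewrite -[X in \sum_(X <= _ < _) (a _)^-1]add0n big_addn {1}/k addKn.
  rewrite [leRHS]big_add1 /=; apply: ler_sum_nat => i /andP[_ ik].
  apply: half => //; apply: le_trans (_ : a (m + k - (i + m).+1)%N + a k <= _).
    have -> : i.+1 = (k - (m + k - (i + m).+1))%N by rewrite /k; lia.
    by apply: le_kappa; rewrite /k; lia.
  by rewrite addnC lerD //; apply: kmin; rewrite /k in kN *; lia.
apply: (@le_trans _ _ (2 / kappa * harmonic_sum (m + N.+1 - k))); last first.
  rewrite ler_wpM2l ?divr_ge0 ?(ltW kappa0) //; apply: harmonic_sum_mono; lia.
rewrite /harmonic_sum big_distrr /= -(add1n k) big_addn.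
apply: ler_sum_nat => i /andP[i0 ik].
apply: half => //; apply: le_trans (_ : a k + a (i + k)%N <= _).
  have -> : i%:R = (i + k - k)%:R :> R by rewrite addnK.
  by apply: le_kappa; lia.
by rewrite lerD2r; apply: kmin; lia.
Qed.

(** Windows of length [l] are peeled off one by one, so the pair condition is only asked at
    distances below [l]. *)
Lemma windows_sum_inv (a : nat -> R) (phi kappa : R) (l q m N : nat) :
  0 < phi -> 0 < kappa -> (N <= q * l)%N ->
  (forall i, (m <= i < m + N)%N -> phi <= a i) ->
  (forall i j, (m <= i < j)%N -> (j < m + N)%N -> (j - i < l)%N ->
     kappa * (j - i)%:R <= a i + a j) ->
  \sum_(m <= i < m + N) (a i)^-1
    <= q%:R * (phi^-1 + 4 / kappa * harmonic_sum l).
Proof.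
move=> phi0 kappa0; elim: q m N => [|q IH] m N Nq le_phi le_kappa.
  by rewrite mul0r big_geq //; lia.
set W := phi^-1 + _.
have W0 : 0 <= W.
  by rewrite addr_ge0 ?mulr_ge0 ?invr_ge0 ?(ltW phi0) ?(ltW kappa0) ?sumr_ge0.
rewrite -[q.+1%:R]natr1 mulrDl mul1r.
have [Nl|lN] := leqP N l.
  apply: le_trans (_ : W <= _); last by rewrite lerDr mulr_ge0.
  by apply: window_sum_inv => // i j ij jN; apply: le_kappa => //; lia.
rewrite (@big_cat_nat _ _ _ (m + l)) /= ?leq_add2l ?leq_addr ?(ltnW lN) //.
rewrite addrC; apply: lerD.
  have -> : (m + N = (m + l) + (N - l))%N by lia.
  by apply: IH => [|i iN|i j ij jN jl]; [lia|apply: le_phi; lia|apply: le_kappa; lia].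
apply: window_sum_inv => // [i iN|i j ij jN]; first by apply: le_phi; lia.
by apply: le_kappa; lia.
Qed.

End Windows.

(** * The push algorithm *)

Section ProductMeasure.
Variables (R : realType) (T J : finType) (P : T -> J -> R).
Hypothesis P_ge0 : forall u j, 0 <= P u j.
Hypothesis P_sum : forall u, \sum_j P u j = 1.
Implicit Types (f : {ffun T -> J}) (phi psi : {ffun T -> J} -> R).

Definition pexp phi : R := \sum_(f : {ffun T -> J}) (\prod_u P u (f u)) * phi f.

Lemma pexp_prod (phi : T -> J -> R) :
  pexp (fun f => \prod_u phi u (f u)) = \prod_u \sum_j P u j * phi u j.
Proof.
by rewrite bigA_distr_bigA; apply: eq_bigr => f _; rewrite -big_split.
Qed.

Lemma pexp_cst (a : R) : pexp (fun=> a) = a.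
Proof.
rewrite /pexp -big_distrl /= -(bigA_distr_bigA P) big1 ?mul1r //.
Qed.

Lemma pexpD phi psi : pexp (fun f => phi f + psi f) = pexp phi + pexp psi.
Proof. by rewrite /pexp -big_split; apply: eq_bigr => f _; rewrite mulrDr. Qed.

Lemma pexpZ (a : R) phi : pexp (fun f => a * phi f) = a * pexp phi.
Proof. by rewrite /pexp big_distrr; apply: eq_bigr => f _; rewrite mulrCA. Qed.

Lemma pexp_sum (K : Type) (r : seq K) (Q : pred K) (phi : K -> {ffun T -> J} -> R) :
  pexp (fun f => \sum_(k <- r | Q k) phi k f) = \sum_(k <- r | Q k) pexp (phi k).
Proof.
by rewrite /pexp exchange_big; apply: eq_bigr => f _; rewrite big_distrr.
Qed.

Lemma ler_pexp phi psi : (forall f, phi f <= psi f) -> pexp phi <= pexp psi.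
Proof.
by move=> le_phi; apply: ler_sum => f _; rewrite ler_wpM2l ?prodr_ge0.
Qed.

(** Independence of two coordinates: the integrand is a product over all coordinates whose other
    factors are 1. *)
Lemma pexp_pair (A : pred J) u u' : u != u' ->
  pexp (fun f => (A (f u))%:R * (A (f u'))%:R)
  = (\sum_(j | A j) P u j) * (\sum_(j | A j) P u' j).
Proof.
move=> uu'; pose phi v j : R := if (v == u) || (v == u') then (A j)%:R else 1.
have PA v : \sum_j P v j * (A j)%:R = \sum_(j | A j) P v j.
  rewrite [RHS]big_mkcond; apply: eq_bigr => j _.
  by case: (A j); rewrite ?mulr1 ?mulr0.
rewrite -!PA; transitivity (pexp (fun f => \prod_v phi v (f v))).
  apply: eq_bigr => f _; congr (_ * _).
  rewrite (bigD1 u) //= (bigD1 u') 1?eq_sym //= /phi !eqxx orbT /= big1 ?mulr1 // => v.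
  by move=> /andP[/negPf-> /negPf->].
rewrite pexp_prod (bigD1 u) //= (bigD1 u') 1?eq_sym //= /phi !eqxx orbT /=.
rewrite [X in _ * (_ * X)]big1 ?mulr1 // => v /andP[/negPf-> /negPf->] /=.
by rewrite -[RHS](P_sum v); apply: eq_bigr => j _; rewrite mulr1.
Qed.

Lemma pexp_hit j : pexp (fun f => (j \in codom f)%:R) = 1 - \prod_u (1 - P u j).
Proof.
have -> : \prod_u (1 - P u j) = pexp (fun f => \prod_u (f u != j)%:R).
  rewrite (pexp_prod (fun _ i => (i != j)%:R)); apply: eq_bigr => u _.
  rewrite [RHS](bigD1 j) //= eqxx mulr0 add0r -[X in X - _](P_sum u) (bigD1 j) //=.
  by rewrite addrAC subrr add0r; apply: eq_bigr => i -> /=; rewrite mulr1.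
apply/eqP; rewrite eq_sym subr_eq -pexpD -[X in X == _]pexp_cst; apply/eqP.
apply: eq_bigr => f _; congr (_ * _); case: (boolP (j \in codom f)) => [/codomP[u ju]|jf].
  by rewrite (bigD1 u) //= -ju eqxx mul0r addr0.
rewrite big1 ?add0r // => u _.
by rewrite (_ : f u != j) //; apply: contraNneq jf => <-; exact: codom_f.
Qed.

End ProductMeasure.

(** Induction on the factors, from [(1 - a) * (1 + a + s) <= 1 + s]. It will bound the probability
    that a vertex is missed by all pushes. *)
Lemma prod_one_sub_le (R : realType) (T : finType) (a : T -> R) :
  (forall u, 0 <= a u <= 1) -> \prod_u (1 - a u) * (1 + \sum_u a u) <= 1.
Proof.
move=> a01; elim: (index_enum T) => [|u r IH].
  by rewrite !big_nil mul1r addr0.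
rewrite !big_cons; have /andP[a0 a1] := a01 u.
have s0 : 0 <= \sum_(j <- r) a j by apply: sumr_ge0 => j _; case/andP: (a01 j).
have p0 : 0 <= \prod_(j <- r) (1 - a j).
  by apply: prodr_ge0 => j _; rewrite subr_ge0; case/andP: (a01 j).
apply: le_trans IH; rewrite mulrAC mulrC ler_wpM2l //; nra.
Qed.

(** Termwise, [1 / (z + i) >= 1 / (y + i) >= 1 / y - i / y ^ 2]. The result involves only [d] and
    [d * (d - 1)], whose expectations are accessible; a free [y >= z] lets the negative term be made
    small. *)
Lemma harmonic_quadratic_bound (R : realType) (z y : R) (d : nat) : 0 < z -> z <= y ->
  d%:R / y - (d * d.-1)%:R / (2 * y ^+ 2) <= \sum_(i < d) (z + i%:R)^-1.
Proof.
move=> z0 zy; have y0 : 0 < y by exact: lt_le_trans zy.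
elim: d => [|d IH]; first by rewrite big_ord0 !mul0r subr0.
rewrite big_ord_recr /=; apply: le_trans (lerD IH (lexx _)).
have le1 : (y + d%:R)^-1 <= (z + d%:R)^-1.
  by rewrite lef_pV2 ?posrE ?ltr_wpDr // lerD2r.
have le2 : y^-1 - d%:R / y ^+ 2 <= (y + d%:R)^-1.
  have yd : 0 < y + d%:R by rewrite ltr_wpDr.
  rewrite -subr_ge0.
  have -> : (y + d%:R)^-1 - (y^-1 - d%:R / y ^+ 2) = d%:R ^+ 2 / (y ^+ 2 * (y + d%:R)).
    by field; rewrite !gt_eqF.
  by rewrite divr_ge0 ?mulr_ge0 ?exprn_ge0 ?ler0n ?(ltW y0) ?(ltW yd).
apply: le_trans (lerD (lexx _) (le_trans le2 le1)).
rewrite -subr_ge0.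
have -> : (d.+1 * d)%:R = (d * d.-1)%:R + 2 * d%:R :> R.
  by rewrite -!natrM -natrD; congr (_%:R); case: d {IH le1 le2} => //= d; lia.
rewrite -[d.+1%:R]natr1 le_eqVlt; apply/orP; left; apply/eqP.
by field; rewrite gt_eqF.
Qed.

(** * Heaviest chains of growing sets *)

Section ChainPotential.
Variables (R : realType) (V : finType) (w : {set V} -> R).
Hypothesis w_ge0 : forall I, 0 <= w I.
Implicit Types (I J D : {set V}).

(** [m] is the number of sets still to be weighed, which makes the recursion structural. Weights
    being nonnegative, the default 0 of the maximum is harmless. *)
Fixpoint chain_weight (m : nat) I : R :=
  if m is m'.+1 then w I + \big[Num.max/0]_(v in ~: I) chain_weight m' (v |: I) else 0.

(* The largest total weight of a maximal chain from [I] to [setT], the end excluded. *)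
Definition potential I := chain_weight #|~: I| I.

Lemma chain_weight_ge0 m I : 0 <= chain_weight m I.
Proof.
by case: m => [|m] //=; rewrite addr_ge0 // bigmax_ge_id.
Qed.

Lemma potential_setU1 I v : v \notin I -> w I + potential (v |: I) <= potential I.
Proof.
move=> vI; rewrite /potential (cardsD1 v (~: I)) inE vI /= lerD2l.
rewrite setCU setIC -setDE.
by apply: (le_bigmax_cond _ (fun v => chain_weight _ (v |: I))); rewrite inE.
Qed.

(** The vertices of [D] are added one at a time, in any order; the set reached after [i] of them has
    weight at least [b i], and [potential_setU1] pays for it. *)
Lemma potential_drop (b : nat -> R) I D :
  D \subset ~: I ->
  (forall J, I \subset J -> J != [set: V] -> b #|J :\: I| <= w J) ->
  potential (I :|: D) + \sum_(i < #|D|) b i <= potential I.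
Proof.
move=> DI le_b; move: {-1}#|D| (erefl #|D|) => d.
elim: d D DI => [|d IH] D DI Dd.
  by rewrite big_ord0 addr0 (cards0_eq Dd) setU0.
have /set0Pn [v vD] : D != set0 by rewrite -card_gt0 Dd.
have D'I : D :\ v \subset ~: I by apply: subset_trans DI; exact: subsetDl.
have D'd : #|D :\ v| = d by move: Dd; rewrite (cardsD1 v) vD => -[].
have vI : v \notin I by have := subsetP DI v vD; rewrite inE.
rewrite big_ord_recr /= [X in _ + X]addrC addrA; apply: le_trans (IH _ D'I D'd).
have -> : I :|: D = v |: (I :|: D :\ v).
  by rewrite setUCA setD1K.
have vJ : v \notin I :|: D :\ v by rewrite !inE eqxx (negPf vI).
rewrite lerD2r addrC; apply: le_trans (potential_setU1 vJ); rewrite lerD2r.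
have JI : (I :|: D :\ v) :\: I = D :\ v.
  apply/setP => x; rewrite !inE; case xI: (x \in I) => //=.
  by apply/esym/negP => /andP[_ xD]; have := subsetP DI x xD; rewrite inE xI.
have := le_b (I :|: D :\ v) (subsetUl _ _); rewrite JI D'd; apply.
by apply: contraNneq vJ => ->; rewrite inE.
Qed.

Lemma chain_weight_attained m I : (m <= #|~: I|)%N ->
  exists J : nat -> {set V},
    [/\ J 0 = I, forall i, (i < m)%N -> exists2 v, v \notin J i & J i.+1 = v |: J i
      & chain_weight m I = \sum_(0 <= i < m) w (J i)].
Proof.
elim: m I => [|m IH] I mI; first by exists (fun=> I); split; rewrite ?big_geq.
have /set0Pn [v0 v0I] : ~: I != set0 by rewrite -card_gt0 (leq_trans _ mI).
have [v vI vmax] := @eq_bigmax _ _ _ 0 v0 (mem (~: I))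
  (fun v => chain_weight m (v |: I)) v0I (fun v _ => chain_weight_ge0 _ _).
have [|J [J0 JS Jw]] := IH (v |: I).
  by move: mI; rewrite (cardsD1 v) vI ltnS setCU setIC -setDE.
exists (fun i => if i is i'.+1 then J i' else I); split => // [[_|i im]|].
- by exists v; rewrite ?J0 //; move: vI; rewrite inE.
- exact: JS.
by rewrite big_nat_recl //= vmax Jw.
Qed.

Lemma potential_attained I : exists J : nat -> {set V},
  [/\ forall i, (i <= #|~: I|)%N -> I \subset J i /\ #|J i| = (#|I| + i)%N,
      forall i j, (i <= j <= #|~: I|)%N -> J i \subset J j
    & potential I = \sum_(0 <= i < #|~: I|) w (J i)].
Proof.
have [J [J0 JS Jw]] := chain_weight_attained (leqnn #|~: I|).
have Jsub i j : (i <= j <= #|~: I|)%N -> J i \subset J j.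
  move=> /andP[ij]; elim: j ij => [|j IH]; first by rewrite leqn0 => /eqP->.
  rewrite leq_eqVlt => /predU1P[->//|ij] jm; apply: subset_trans (IH _ (ltnW jm)) _ => //.
  by have [v _ ->] := JS j jm; exact: subsetUr.
exists J; split=> // i im; split; first by rewrite -J0 Jsub // im.
elim: i im => [|i IH] im; first by rewrite J0 addn0.
have [v vJ ->] := JS i im.
by rewrite cardsU1 vJ IH ?(ltnW im) // addnS.
Qed.

End ChainPotential.

(** * One round of the push algorithm *)

Section Broadcast.
Variables (R : realType) (V : finType) (e : rel V).
Hypothesis e_sym : symmetric e.
Hypothesis deg_pos : forall v, (0 < deg e v)%N.
Implicit Types (I J D : {set V}) (v w : V).

Notation push_measure I := (fun u : {v : V | v \in I} => nbr_prob R e (val u)).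

Lemma push_prob_pexp I (g : {set V} -> R) :
  \sum_J push_prob R e I J * g J
  = pexp (push_measure I) (fun f => g (I :|: [set w in codom f])).
Proof.
rewrite /pexp (partition_big (fun f : {ffun {v : V | v \in I} -> V} =>
  I :|: [set w in codom f]) xpredT) //=; apply: eq_bigr => J _.
by rewrite /push_prob big_distrl; apply: eq_bigr => f /eqP <-.
Qed.

Lemma push_prob_ge0 I J : 0 <= push_prob R e I J.
Proof.
by apply: sumr_ge0 => f _; apply: prodr_ge0 => u _; exact: nbr_prob_ge0.
Qed.

Lemma push_prob_sum I : \sum_J push_prob R e I J = 1.
Proof.
have := push_prob_pexp I (fun=> 1); rewrite pexp_cst; last by move=> u; exact: nbr_prob_sum.
by under eq_bigr => J _ do rewrite mulr1.
Qed.

Lemma push_prob_sub I J : push_prob R e I J != 0 -> I \subset J.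
Proof.
apply: contraR => IJ; rewrite /push_prob big_pred0 // => f.
by apply: contraNF IJ => /eqP <-; exact: subsetUl.
Qed.

Section Drift.
Variables (c : R) (I : {set V}).
Hypothesis c_ge1 : 1 <= c.
Hypothesis degs : (maxdeg e)%:R <= c * (mindeg e)%:R :> R.

Let Delta : R := (maxdeg e)%:R.
Let z : R := (cut e I)%:R / Delta.
Let E := pexp (push_measure I).

Let P_ge0 (u : {v : V | v \in I}) w : 0 <= nbr_prob R e (val u) w.
Proof. exact: nbr_prob_ge0. Qed.

Let P_sum (u : {v : V | v \in I}) : \sum_w nbr_prob R e (val u) w = 1.
Proof. exact: nbr_prob_sum. Qed.

Let Delta_ge_deg v : (deg e v)%:R <= Delta.
Proof. by rewrite ler_nat deg_le_maxdeg. Qed.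

Let Delta_gt0 (v : V) : 0 < Delta.
Proof. by apply: lt_le_trans (Delta_ge_deg v); rewrite ltr0n. Qed.

Definition newly (f : {ffun {v : V | v \in I} -> V}) : {set V} :=
  [set w in codom f] :\: I.

Let card_newlyE f : #|newly f|%:R = \sum_(w in ~: I) (w \in codom f)%:R :> R.
Proof.
rewrite -natr_sum -sum1_card; congr (_%:R); rewrite [LHS]big_mkcond [RHS]big_mkcond.
by apply: eq_bigr => w _; rewrite !inE; case: (w \in I); case: (w \in codom f).
Qed.

(** Let [x] be the number of informed neighbours of an outside vertex [w] divided by [Delta]. All
    pushes miss [w] with probability at most [1 / (1 + x)], so [w] is hit with probability at least
    [x / 2], as [x <= 1]. The values [x] add up to [z]. *)
Lemma expected_newly_ge : z / 2 <= E (fun f => #|newly f|%:R).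
Proof.
have [v0 _|noV] := pickP (mem (~: I)); last first.
  rewrite /z /cut big1 ?mul0r; last by move=> v _; rewrite /outdeg big_pred0.
  by apply: sumr_ge0 => f _; rewrite mulr_ge0 ?prodr_ge0.
have Delta_pos := Delta_gt0 v0.
rewrite (_ : E _ = \sum_(w in ~: I) E (fun f => (w \in codom f)%:R)); last first.
  by rewrite /E -pexp_sum; apply: eq_bigr => f _; rewrite card_newlyE.
rewrite /z /cut natr_sum -mulrA big_distrl /=.
under eq_bigr => v _ do rewrite /outdeg natr_sum big_distrl /=.
rewrite exchange_big; apply: ler_sum => w wI; rewrite /E pexp_hit; last exact: P_sum.
rewrite -big_distrl /= mulrA.
set x := _ / Delta; set q := \prod_u _.
have x0 : 0 <= x by rewrite divr_ge0 ?sumr_ge0 ?ltW.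
have x1 : x <= 1.
  rewrite ler_pdivrMr // mul1r -natr_sum; apply: le_trans (Delta_ge_deg w).
  rewrite ler_nat (deg_split e I) (eq_bigr (fun v => nat_of_bool (e w v))) ?leq_addr //.
  by move=> v _; rewrite e_sym.
have P01 (u : {v : V | v \in I}) : 0 <= nbr_prob R e (val u) w <= 1.
  rewrite P_ge0 -(P_sum u) (bigD1 w) //= lerDl sumr_ge0 // => i _.
  exact: nbr_prob_ge0.
have q0 : 0 <= q.
  by apply: prodr_ge0 => u _; rewrite subr_ge0; have /andP[] := P01 u.
have qs : q * (1 + x) <= 1.
  apply: le_trans (prod_one_sub_le P01); rewrite ler_wpM2l // lerD2l.
  rewrite -(big_sub (mem I) (fun v => nbr_prob R e v w)) /x big_distrl.
  apply: ler_sum => v vI; rewrite nbr_probE.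
  by rewrite ler_wpM2l // lef_pV2 ?posrE ?Delta_ge_deg // ltr0n.
by nra.
Qed.

(** Ordered pairs of distinct new vertices are at most as many as ordered pairs of distinct callers
    pushing out of [I]. By independence their expected number is at most the square of the expected
    number of outward pushes, itself at most [c * z]. *)
Lemma expected_newly_pairs_le :
  E (fun f => (#|newly f| * #|newly f|.-1)%:R) <= (c * z) ^+ 2.
Proof.
pose chi (f : {ffun {v : V | v \in I} -> V}) u : R := (f u \notin I)%:R.
have pairs f : (#|newly f| * #|newly f|.-1)%:R
    <= \sum_u \sum_(u' | u != u') chi f u * chi f u'.
  pose X := #|[set u | f u \notin I]|.
  have leX : (#|newly f| <= X)%N.
    apply: leq_trans (leq_imset_card f _); apply: subset_leq_card.
    apply/subsetP => w; rewrite !inE => /andP[wI /codomP[u wu]].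
    by rewrite wu imset_f // inE -wu.
  have XE : X%:R = \sum_u chi f u.
    rewrite -natr_sum /X -sum1_card big_mkcond; congr (_%:R); apply: eq_bigr => u _.
    by rewrite inE; case: (_ \notin _).
  apply: (@le_trans _ _ (X * X.-1)%:R).
    by rewrite ler_nat leq_mul // -!subn1 leq_sub2r.
  (* Since [chi] is 0 or 1, subtracting [X] from its square removes exactly the diagonal pairs. *)
  have -> : (X * X.-1)%:R = X%:R ^+ 2 - X%:R :> R.
    by case: X {leX XE} => [|X] /=; rewrite ?muln0 ?expr0n ?subrr // natrM -natr1; ring.
  rewrite XE expr2 big_distrl /= -sumrB; apply: ler_sum => u _.
  rewrite big_distrr /= (bigD1 u) //= lerBlDr addrC lerD //.
    by rewrite (eq_bigl (fun u' => u != u')) // => u'; rewrite eq_sym.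
  by rewrite /chi; case: (_ \notin _); rewrite ?mulr1 ?mulr0.
apply: le_trans (ler_pexp P_ge0 pairs) _.
pose q (u : {v : V | v \in I}) := \sum_(w in ~: I) nbr_prob R e (val u) w.
have q0 u : 0 <= q u by apply: sumr_ge0 => w _; exact: P_ge0.
rewrite pexp_sum; apply: (@le_trans _ _ ((\sum_u q u) ^+ 2)).
  rewrite expr2 big_distrl; apply: ler_sum => u _; rewrite pexp_sum big_distrr /=.
  rewrite [leRHS](bigID (fun u' => u != u')) /=.
  rewrite -[leLHS]addr0; apply: lerD.
    apply: ler_sum => u' uu'; rewrite /q.
    rewrite (pexp_pair P_sum (fun w => w \notin I) uu') le_eqVlt; apply/orP; left; apply/eqP.
    by congr (_ * _); apply: eq_bigl => w; rewrite inE.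
  by rewrite sumr_ge0 // => u' _; rewrite mulr_ge0.
have qz : \sum_u q u <= c * z.
  rewrite -(big_sub (mem I) (fun v => \sum_(w in ~: I) nbr_prob R e v w)) /z /cut natr_sum.
  rewrite big_distrl big_distrr /=; apply: ler_sum => v vI.
  under eq_bigr => w _ do rewrite nbr_probE.
  rewrite -big_distrl /= -natr_sum mulrCA ler_wpM2l //.
  have Delta_pos := Delta_gt0 v.
  rewrite ler_pdivlMr // mulrC ler_pdivrMr ?ltr0n //.
  apply: le_trans degs _; rewrite ler_wpM2l ?ler_nat ?mindeg_le //.
  exact: le_trans c_ge1.
by rewrite ler_pXn2r ?nnegrE ?sumr_ge0 // (le_trans _ qz) ?sumr_ge0.
Qed.

Definition cut_weight J : R := 8 * c ^+ 2 * (Delta / (cut e J)%:R).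

(* With [d] newly informed vertices and [z = cut I / Delta], the potential drops by at
   least [8 c^2 sum_(i < d) 1 / (z + i)], because each vertex raises the cut by at most
   [Delta]. The quadratic minorant of this sum at [y = 2 c^2 z] has expectation at least
   1, by the bounds on the first two factorial moments of [d]. *)
Lemma push_drift :
  (forall J, J != set0 -> J != [set: V] -> (0 < cut e J)%N) ->
  I != set0 -> I != [set: V] ->
  1 + \sum_J push_prob R e I J * potential cut_weight J <= potential cut_weight I.
Proof.
move=> cuts_pos I0 IT; have cut_pos := cuts_pos _ I0 IT.
have c0 : 0 < c by exact: lt_le_trans c_ge1.
have /set0Pn [v0 v0I] := I0.
have Delta_pos := Delta_gt0 v0.
have z0 : 0 < z by rewrite divr_gt0 // ltr0n.
pose y := 2 * c ^+ 2 * z.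
have y0 : 0 < y by rewrite mulr_gt0 // mulr_gt0 // exprn_gt0.
have zy : z <= y by rewrite /y -{1}[z]mul1r ler_wpM2r ?(ltW z0) //; have := exprn_ege1 2 c_ge1; lra.
(* [cut_setU1] iterated over the vertices of [J :\: I]. *)
have card_cut J : I \subset J -> ((cut e J) <= cut e I + #|J :\: I| * maxdeg e)%N.
  move: {-1}#|J :\: I| (erefl #|J :\: I|) => d; elim: d J => [|d IH] J Jd IJ.
    rewrite mul0n addn0 (_ : J = I) //; apply/eqP; rewrite eqEsubset IJ andbT.
    by rewrite -setD_eq0 -cards_eq0 Jd.
  have /set0Pn [v] : J :\: I != set0 by rewrite -card_gt0 Jd.
  rewrite inE => /andP[vI vJ]; rewrite -(setD1K vJ).
  apply: leq_trans (cut_setU1 e _) _; first by rewrite !inE eqxx.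
  rewrite mulSn addnCA addnC leq_add2l; apply: IH.
    by move: Jd; rewrite (cardsD1 v) !inE vI vJ !setDDl [v |: I]setUC => -[].
  by apply/subsetP => x xI; rewrite !inE (subsetP IJ) // andbT; apply: contraNneq vI => <-.
have drop (f : {ffun {v : V | v \in I} -> V}) : potential cut_weight (I :|: [set w in codom f])
    + 8 * c ^+ 2 * (#|newly f|%:R / y - (#|newly f| * #|newly f|.-1)%:R / (2 * y ^+ 2))
    <= potential cut_weight I.
  have -> : I :|: [set w in codom f] = I :|: newly f.
    by apply/setP => x; rewrite !inE; case: (x \in I).
  have newI : newly f \subset ~: I by apply/subsetP => x; rewrite !inE => /andP[].
  apply: le_trans (@potential_drop _ _ cut_weight
     (fun i => 8 * c ^+ 2 * (z + i%:R)^-1) _ _ newI _).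
    rewrite lerD2l -big_distrr /= ler_wpM2l ?mulr_ge0 ?exprn_ge0 ?(ltW c0) //.
    exact: harmonic_quadratic_bound.
  move=> J IJ JT; have cutJ : (0 < cut e J)%N.
    by apply: cuts_pos => //; apply/set0Pn; exists v0; exact: (subsetP IJ).
  rewrite /cut_weight ler_wpM2l ?mulr_ge0 ?exprn_ge0 ?(ltW c0) //.
  have cutJR : 0 < (cut e J)%:R :> R by rewrite ltr0n.
  rewrite -[leRHS]invrK invf_div lef_pV2 ?posrE ?divr_gt0 ?ltr_wpDr //.
  rewrite ler_pdivrMr // mulrDl divfK ?gt_eqF // -natrM -natrD ler_nat.
  exact: card_cut.
rewrite (push_prob_pexp I (potential cut_weight)) -/E.
pose F (f : {ffun {v : V | v \in I} -> V}) : R := 8 * c ^+ 2 / y * #|newly f|%:R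
  + - (8 * c ^+ 2 / (2 * y ^+ 2)) * (#|newly f| * #|newly f|.-1)%:R.
have := ler_pexp P_ge0 drop.
rewrite pexp_cst; last exact: P_sum.
rewrite pexpD -/E => /(le_trans _); apply; rewrite addrC lerD2l.
rewrite (_ : E _ = E F); last first.
  by apply: eq_bigr => f _; congr (_ * _); rewrite /F; field; rewrite gt_eqF.
rewrite /E pexpD !pexpZ -/E.
have := expected_newly_ge; have := expected_newly_pairs_le.
set a := E _; set b := E _ => le_a le_b.
(* With [y = 2 * c ^ 2 * z] the two terms are 2 and 1; this fixes the factor [8 * c ^ 2] in
   [cut_weight]. *)
have ident : 1 = 8 * c ^+ 2 / y * (z / 2) - 8 * c ^+ 2 / (2 * y ^+ 2) * (c * z) ^+ 2 :> R.
  by rewrite /y; field; rewrite !gt_eqF.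
rewrite [leLHS]ident mulNr; apply: lerB.
  by rewrite ler_wpM2l // divr_ge0 ?(ltW y0) // mulr_ge0 ?exprn_ge0 ?(ltW c0).
by rewrite ler_wpM2l // divr_ge0 // mulr_ge0 ?exprn_ge0 ?(ltW c0) ?(ltW y0).
Qed.

End Drift.

End Broadcast.

(** * Broadcast time from cuts, cuts from cover time *)

Section BroadcastTime.
Variables (R : realType) (V : finType) (e : rel V) (c : R).
Hypothesis e_sym : symmetric e.
Hypothesis e_conn : forall x y : V, connect e x y.
Hypothesis card_gt1 : (1 < #|V|)%N.
Hypothesis c_ge1 : 1 <= c.
Hypothesis degs : (maxdeg e)%:R <= c * (mindeg e)%:R :> R.

Let deg_pos v : (0 < deg e v)%N.
Proof. exact: deg_gt0. Qed.

Let mindeg_pos : (0 < mindeg e)%N.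
Proof. exact: mindeg_gt0. Qed.

Let delta_gt0 : 0 < (mindeg e)%:R :> R.
Proof. by rewrite ltr0n. Qed.

(** The numerator of [cut_weight], times a bound on the number of windows, times the bound for one
    window with [kappa] half the minimum degree. *)
Definition broadcast_bound (phi : R) : R :=
  8 * c ^+ 2 * (maxdeg e)%:R * (3 * #|V|%:R / (mindeg e)%:R)
  * (phi^-1 + 8 / (mindeg e)%:R * (1 + ln #|V|%:R)).

Lemma potential_cut_weight_le (phi : R) (I : {set V}) : 0 < phi -> I != set0 ->
  (forall J, J != set0 -> J != [set: V] -> phi <= (cut e J)%:R) ->
  potential (cut_weight e c) I <= broadcast_bound phi.
Proof.
move=> phi0 I0 le_phi.
have c0 : 0 <= c by exact: le_trans c_ge1.
have w_ge0 J : 0 <= cut_weight e c J by rewrite !mulr_ge0 ?exprn_ge0.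
have [J [JI Jsub ->]] := potential_attained w_ge0 I.
set N := #|~: I|.
have cardI : (#|I| + N = #|V|)%N by rewrite /N cardsC.
(* Two sets of one window differ by at most [d / 2] vertices, so [cut_small] gives their difference
   a cut of at least [d / 2] edges per vertex. *)
set d := mindeg e; set l := d./2.+1.
pose q := (N %/ l).+1.
rewrite /cut_weight -!big_distrr /= mulrA /broadcast_bound -/d -[leRHS]mulrA.
rewrite ler_wpM2l ?mulr_ge0 ?exprn_ge0 //.
have := @windows_sum_inv R (fun i => (cut e (J i))%:R) phi (d%:R / 2) l q 0 N phi0.
rewrite add0n; move=> /(_ _ _ _ _)/le_trans; apply.
- by rewrite divr_gt0.
- by rewrite /q ltnW // ltn_ceil.
- move=> i /= iN; have [IJ cJ] := JI i (ltnW iN); apply: le_phi.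
    by apply: contraNneq I0 => Ji0; rewrite -subset0 -Ji0.
  apply: contraTneq iN => JT; rewrite -leqNgt -(leq_add2l #|I|) -cJ JT cardsT.
  by rewrite cardI.
- move=> i j /= ij jN jil; have [_ ci] := JI i (ltnW (ltn_trans ij jN)).
  have [_ cj] := JI j (ltnW jN).
  have sub_ij : J i \subset J j by apply: Jsub; rewrite (ltnW ij) (ltnW jN).
  have := leq_trans (cut_small e (J j :\: J i)) (cut_setD e_sym sub_ij).
  have -> : #|J j :\: J i| = (j - i)%N.
    by rewrite cardsD (setIidPr sub_ij) ci cj subnDl.
  rewrite -/d mulrAC ler_pdivrMr // -natrD -!natrM ler_nat => le2.
  by rewrite /l in jil; nia.
rewrite ler_pM //.
- rewrite addr_ge0 ?invr_ge0 ?(ltW phi0) // mulr_ge0 ?divr_ge0 ?sumr_ge0 //.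
(* From [d <= 2 * l] and [d <= #|V|] follows [q * d <= 2 * N + d <= 3 * #|V|]. *)
- rewrite ler_pdivlMr // -!natrM ler_nat /q.
  have := leq_divM N l; have : (d <= #|V|)%N by exact: mindeg_le_card.
  rewrite /l; nia.
rewrite lerD2l invf_div mulrA -natrM ler_wpM2l ?divr_ge0 //.
apply: le_trans (harmonic_sum_le_ln R #|V|); apply: harmonic_sum_mono.
by have := mindeg_le_card e; rewrite /l -/d; lia.
Qed.

Lemma RBA_le (phi : R) : 0 < phi ->
  (forall J, J != set0 -> J != [set: V] -> phi <= (cut e J)%:R) ->
  (RBA R e <= (broadcast_bound phi)%:E)%E.
Proof.
move=> phi0 le_phi; apply: bigmax_le => [|s _]; first by rewrite leNye.
have s0 : [set s] != set0 by apply/set0Pn; exists s; rewrite inE.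
have c0 : 0 <= c by exact: le_trans c_ge1.
apply: (@le_trans _ _ (potential (cut_weight e c) [set s])%:E); last first.
  by rewrite lee_fin potential_cut_weight_le.
apply: (expected_stop_supermartingale (push_prob_ge0 R e) (push_prob_sum R deg_pos)
  (Q := fun I => I != set0) (B := fun I => I == [set: V])) => //.
- move=> I J I0 _ /push_prob_sub IJ.
  by apply: contraNneq I0 => J0; rewrite -subset0 -J0.
- by move=> I; apply: chain_weight_ge0 => J; rewrite !mulr_ge0 ?exprn_ge0.
- move=> I I0 IT; apply: push_drift => // J J0 JT; exact: cut_gt0.
Qed.

Lemma RBA_ge0 (v : V) : (0 <= RBA R e)%E.
Proof.
apply: le_trans (le_bigmax _ _ v).
exact: expected_stop_ge0 (push_prob_ge0 R e) (push_prob_sum R deg_pos) _ _.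
Qed.

Lemma COV_mindeg_cut (M : R) (U : {set V}) : COV R e = M%:E -> U != [set: V] ->
  #|U|%:R * (mindeg e)%:R <= M * (cut e U)%:R.
Proof.
move=> covM UT; apply: le_trans (COV_cut e_sym deg_pos covM UT).
rewrite -natr_sum -natrM ler_nat -sum_nat_const; apply: leq_sum => v _.
exact: mindeg_le.
Qed.

(** The complement of a vertex has volume at least [(n - 1) * delta] and cut at most [c * delta];
    finally [n <= 2 * (n - 1)]. *)
Lemma COV_ge_card (M : R) : COV R e = M%:E -> #|V|%:R <= 2 * c * M.
Proof.
move=> covM; have [v _] : exists v : V, v \in V.
  exact/card_gt0P/ltnW.
have M0 : 0 <= M by rewrite -lee_fin -covM (COV_ge0 R deg_pos v).
have UT : ~: [set v] != [set: V].
  by apply/eqP => /setP/(_ v); rewrite !inE eqxx.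
have := COV_mindeg_cut covM UT; rewrite cutC // cardsC1 => le1.
have le2 : (cut e [set v])%:R <= c * (mindeg e)%:R.
  apply: le_trans degs; rewrite ler_nat /cut big_set1.
  exact: leq_trans (outdeg_le _ _ _) (deg_le_maxdeg _ _).
have : #|V|.-1%:R <= M * c.
  rewrite -(ler_pM2r delta_gt0) -mulrA; apply: le_trans le1 _.
  by rewrite ler_wpM2l.
have : #|V|%:R <= 2 * #|V|.-1%:R :> R by rewrite -natrM ler_nat; lia.
by lra.
Qed.

(** Add the bounds for [U] and its complement, which share the same cut. *)
Lemma COV_cut_ge (M : R) (U : {set V}) : COV R e = M%:E ->
  U != set0 -> U != [set: V] -> #|V|%:R * (mindeg e)%:R <= 2 * M * (cut e U)%:R.
Proof.
move=> covM U0 UT.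
have UC : ~: U != [set: V] by rewrite -subTset -setCS setCK setCT subset0.
have := COV_mindeg_cut covM UT; have := COV_mindeg_cut covM UC.
by rewrite cutC // -(cardsC U) natrD; lra.
Qed.

End BroadcastTime.

(** * Comparison of the two times *)

Lemma ln_ge_half (R : realType) (n : nat) : (1 < n)%N -> 1 / 2 <= ln n%:R :> R.
Proof.
move=> n1; apply: (@le_trans _ _ (ln 2)); last first.
  by rewrite ler_ln ?posrE ?ltr0n ?ler_nat // ltnW.
have : ln (1 + - (1 / 2)) <= - (1 / 2) :> R by apply: le_ln1Dx; lra.
have -> : 1 + - (1 / 2) = 2^-1 :> R by lra.
by rewrite lnV ?posrE // lerN2.
Qed.

(** The case [r = 0] is included: the inverse of 0 is then [+oo], and [M > 0] makes the quotient
    infinite. *)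
Lemma le_div_ereal (R : realType) (a M G : R) (r : \bar R) :
  0 <= a -> 0 < M -> a * G <= M -> (0 <= r <= G%:E)%E -> (a%:E <= M%:E / r)%E.
Proof.
move=> a0 M0 aG /andP[]; case: r => [r||] //=; rewrite !lee_fin inver => r0 rG.
have [_|rn0] := eqVneq r 0; first by rewrite gt0_muley ?lte_fin // leey.
rewrite -EFinM lee_fin ler_pdivlMr ?lt_def ?rn0 //.
by apply: le_trans aG; rewrite ler_wpM2l.
Qed.

Theorem corollary4p10 (R : realType) (c : R) (hc : 1 <= c) :
  exists C : R, 0 < C /\
    forall (V : finType) (e : rel V),
      symmetric e -> irreflexive e -> (forall x y : V, connect e x y) ->
      (2 <= #|V|)%N ->
      (maxdeg e)%:R <= c * (mindeg e)%:R ->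
      ((C * ((mindeg e)%:R ^+ 2 / #|V|%:R) * (1 / ln #|V|%:R))%:E
        <= cover_broadcast_ratio R e)%E.
Proof.
have c0 : 0 < c by exact: lt_le_trans hc.
(* [24 * c ^ 3] collects [8 * c ^ 2], the factor 3 and [maxdeg <= c * mindeg]; [4 + 48 * c] comes
   from [le_X]. *)
pose A := 24 * c ^+ 3 * (4 + 48 * c).
have A0 : 0 < A by rewrite mulr_gt0 ?mulr_gt0 ?exprn_gt0 ?addr_gt0 ?mulr_gt0.
exists A^-1; split; first by rewrite invr_gt0.
move=> V e e_sym _ e_conn card_gt1 degs.
have [v _] : exists v : V, v \in V.
  exact/card_gt0P/ltnW.
have deg_pos w : (0 < deg e w)%N by exact: deg_gt0.
have RBA0 := RBA_ge0 R e_sym e_conn card_gt1 v.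
have ln_n : 1 / 2 <= ln #|V|%:R :> R by exact: ln_ge_half.
have d0 : 0 < (mindeg e)%:R :> R by rewrite ltr0n mindeg_gt0.
have n0 : 0 < #|V|%:R :> R by rewrite ltr0n ltnW.
have dn : (mindeg e)%:R <= #|V|%:R :> R by rewrite ler_nat mindeg_le_card.
have RBA_le phi := RBA_le e_sym e_conn card_gt1 hc degs (phi := phi).
rewrite /cover_broadcast_ratio.
case covM : (COV R e) => [M||].
- have nM := COV_ge_card e_sym e_conn card_gt1 hc degs covM.
  have M0 : 0 < M.
    have : 0 < 2 * c * M by exact: lt_le_trans nM.
    by rewrite pmulr_rgt0 // mulr_gt0.
  pose phi := #|V|%:R * (mindeg e)%:R / (2 * M).
  have phi0 : 0 < phi by rewrite divr_gt0 ?mulr_gt0.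
  have RBAG := RBA_le phi phi0 _.
  apply: (@le_div_ereal _ _ _ (broadcast_bound e c phi)) => //.
  + by rewrite !mulr_ge0 ?exprn_ge0 ?invr_ge0 ?(ltW A0) ?(ltW n0) //; lra.
  + move: RBAG => _; rewrite /broadcast_bound.
    set D := (maxdeg e)%:R in degs *; set d := (mindeg e)%:R in d0 dn degs *.
    set n := #|V|%:R in n0 dn nM ln_n *; set L := ln n in ln_n *.
    have L0 : 0 < L by lra.
    (* As [1 <= 2 * L], one has [2 * M <= 4 * M * L] and [8 * n * (1 + L) <= 24 * n * L], and
       [n <= 2 * c * M] makes the latter at most [48 * c * M * L]. *)
    have le_X : phi^-1 + 8 / d * (1 + L) <= (4 + 48 * c) * M * L / (n * d).
      have -> : phi^-1 + 8 / d * (1 + L) = (2 * M + 8 * n * (1 + L)) / (n * d).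
        by rewrite /phi -/n -/d; field; rewrite !gt_eqF.
      rewrite ler_wpM2r ?invr_ge0 ?mulr_ge0 ?(ltW n0) ?(ltW d0) //.
      have ML : M * (1 / 2) <= M * L by rewrite ler_wpM2l ?(ltW M0).
      have nL : n * (1 / 2) <= n * L by rewrite ler_wpM2l ?(ltW n0).
      have nML : n * L <= 2 * c * M * L by rewrite ler_wpM2r // ltW.
      by lra.
    apply: (@le_trans _ _ (A^-1 * (d ^+ 2 / n) * (1 / L)
        * (8 * c ^+ 2 * (c * d) * (3 * n / d) * ((4 + 48 * c) * M * L / (n * d))))).
      rewrite ler_wpM2l ?mulr_ge0 ?exprn_ge0 ?invr_ge0 ?(ltW A0) ?(ltW n0) ?(ltW L0) //.
      apply: ler_pM => //.
      * by rewrite !mulr_ge0 ?exprn_ge0 ?invr_ge0 ?(ltW c0) ?(ltW n0) ?(ltW d0) ?ler0n.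
      * rewrite addr_ge0 ?invr_ge0 ?(ltW phi0) // mulr_ge0 ?divr_ge0 ?(ltW d0) //.
        by rewrite addr_ge0 // ltW.
      rewrite ler_wpM2r ?mulr_ge0 ?invr_ge0 ?(ltW n0) ?(ltW d0) //.
      by rewrite ler_wpM2l // mulr_ge0 // exprn_ge0 // ltW.
    (* All constants cancel; the remaining factor [d / n] is at most 1. *)
    rewrite [leLHS](_ : _ = M * (d / n)); last first.
      by rewrite /A; field; rewrite !gt_eqF //; lra.
    by rewrite ler_piMr ?(ltW M0) // ler_pdivrMr // mul1r.
  + rewrite RBA0 RBAG // => J J0 JT; rewrite ler_pdivrMr ?mulr_gt0 //.
    by rewrite [leRHS]mulrC; apply: COV_cut_ge.
(* For infinite cover time, cuts of at least one edge still make [RBA] finite, so the ratio is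
   [+oo]. *)
- have := RBA_le 1 ltr01 _; move: RBA0.
  case: (RBA R e) => [r||] // r0 => [_|le_y]; last first.
    have : (+oo <= (broadcast_bound e c 1)%:E)%E.
      by apply: le_y => J J0 JT; rewrite ler1n cut_gt0.
    by [].
  rewrite inver; case: eqVneq => [_|rn0]; first by rewrite mulyy leey.
  by rewrite gt0_mulye ?leey // lte_fin invr_gt0 lt_def rn0.
- by have := COV_ge0 R deg_pos v; rewrite covM.
Qed.
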